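(* For all integers $k\ge 2$ and $\ell\ge1$ there exist a finite point set $X\subseteq\mathbb{R}^d$ and a rule $\mathcal{R}$ such that general $k$-means++ with parameters $k,\ell$ and rule $\mathcal{R}$, run on $X$, outputs with constant probability (bounded below by an absolute constant) a set $C$ of centers with $\phi(X,C)\ge \Omega(k^{1-1/\ell})\cdot\mathrm{OPT}_k(X)$.
   Context: For $x\in\mathbb{R}^d$ and finite $C\subseteq\mathbb{R}^d$, $\phi(x,C)=\min_{c\in C}\|x-c\|_2^2$, $\phi(Y,C)=\sum_{x\in Y}\phi(x,C)$; $\mathrm{OPT}_k(X)$ is the minimum of $\phi(X,C)$ over all $C\subseteq\mathbb{R}^d$ with $|C|=k$. A rule $\mathcal{R}$ is any (possibly randomized) procedure that, given $X$, the current center set, $k$, $\ell$ and $\ell$ candidate points $x_1,\dots,x_\ell$, selects one of the candidates. General $k$-means++ with rule $\mathcal{R}$: sample $x_1,\dots,x_\ell\in X$ independently uniformly, let $\mathcal{R}$ select one of them as $c_1$, $C_1=\{c_1\}$; for $i=1,\dots,k-1$ sample $c_{i+1}^1,\dots,c_{i+1}^\ell\in X$ independently, each equal to $x$ with probability $\phi(x,C_i)/\phi(X,C_i)$, let $\mathcal{R}$ select $c_{i+1}$ among them, and set $C_{i+1}=C_i\cup\{c_{i+1}\}$; output $C_k$. *)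

(* Defs.v *)
From HB Require Import structures.
From mathcomp Require Import all_boot all_order all_algebra.
From mathcomp Require Import all_classical all_reals all_analysis.
Set Implicit Arguments. Unset Strict Implicit. Unset Printing Implicit Defensive.
Import Order.TTheory GRing.Theory Num.Theory.
Local Open Scope classical_set_scope.
Local Open Scope ring_scope.

Section KMPP.
Variables (R : realType) (d : nat).
Notation point := 'rV[R]_d.

Definition sqdist (x c : point) : R := \sum_(i < d) (x 0 i - c 0 i) ^+ 2.

(* phi(x, C) = min_{c in C} ||x - c||^2 ; convention phi(x, [::]) = 0
   (only used so that the first center is drawn uniformly, see d2prob) *)
Definition phi_pt (x : point) (C : seq point) : R :=
  match C with
  | [::] => 0
  | c :: cs => foldr (fun c' m => Num.min (sqdist x c') m) (sqdist x c) cs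
  end.

Definition phi_set (Y C : seq point) : R := \sum_(y <- Y) phi_pt y C.

Definition OPT (k : nat) (Y : seq point) : R :=
  inf ((fun C => phi_set Y C) @` [set C : seq point | uniq C /\ size C = k]).

(* A (possibly randomized) rule: given the current centers and the l
   candidates, a probability distribution on the candidate indices.
   (X, k, l are fixed along with the rule.) *)
Definition rule (l : nat) := seq point -> {ffun 'I_l -> point} -> 'I_l -> R.

Definition is_rule (l : nat) (r : rule l) : Prop :=
  [/\ (forall C t j, 0 <= r C t j),
      (forall C t, \sum_(j < l) r C t j = 1) &
      (forall C C' t, C =i C' -> r C t = r C' t)].

Variables (n : nat) (X : 'I_n -> point).

Definition Xs : seq point := map X (enum 'I_n).

(* probability of sampling X i given current centers C: D^2 sampling,
   uniform when phi(X,C) = 0 (in particular for C = [::], the first step) *)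
Definition d2prob (C : seq point) (i : 'I_n) : R :=
  let tot := phi_set Xs C in
  if 0 < tot then phi_pt (X i) C / tot else n%:R^-1.

Variables (l : nat) (r : rule l).

Fixpoint succ_prob (E : seq point -> bool) (m : nat) (C : seq point) : R :=
  match m with
  | 0 => if E C then 1 else 0
  | m'.+1 =>
      \sum_(t : {ffun 'I_l -> 'I_n})
        (\prod_(j < l) d2prob C (t j)) *
        \sum_(j < l) r C [ffun j' => X (t j')] j *
                     succ_prob E m' (rcons C (X (t j)))
  end.

Definition kmpp_prob (k : nat) (E : seq point -> bool) : R :=
  succ_prob E k [::].

End KMPP.

(* Main.v *)
Require Import Defs.
From HB Require Import structures.
From mathcomp Require Import all_boot all_order all_algebra.
From mathcomp Require Import all_classical all_reals all_analysis.
From mathcomp Require Import lra zify.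
Set Implicit Arguments.
Unset Strict Implicit.
Unset Printing Implicit Defensive.
Import Order.TTheory GRing.Theory Num.Theory.
Local Open Scope ring_scope.

(** The instance consists of [k + M] mutually orthogonal points, with [2 M] about
    [k ^ (1 - 1 / l)]: [k - 1] remote singletons, and one tiny cluster made of a
    tight core of [M] points and an outlier, the bad point.  Using the bad point
    as the center of the cluster costs about [M / 2] times more than using the
    core.  The rule picks the bad point as soon as it is a candidate and avoids
    the core whenever it can.  During the first [k / 2] steps at least [k / 2]
    points outside the core are still expensive, so all [l] candidates lie in
    the core with probability at most [(2 M / k) ^ l <= 1 / k], whereas the bad
    point is a candidate with probability at least [1 / (4 k)]; hence with
    constant probability the bad point is picked before the core is hit.  From
    then on the cluster has negligible cost compared with the remaining
    singletons, and its core is never sampled again with probability at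
    least 1/2.  If [k ^ (1 - 1 / l) < 2], the instance with [M = 1] has [k + 1]
    points, and any [k] of them are a sufficiently bad solution. *)

(** * Independent samples from a finite distribution *)

Section IidSample.
Context {R : realFieldType} {T I : finType}.
Variable w : T -> R.
Implicit Types t : {ffun I -> T}.

Lemma iid_all (P : pred T) :
  \sum_(t : {ffun I -> T} | [forall j, P (t j)]) \prod_j w (t j) =
  (\sum_(i | P i) w i) ^+ #|I|.
Proof.
rewrite -prodr_const (bigA_distr_big P (fun _ i => w i)) /=.
by apply: eq_bigl => t; apply/forallP/ffun_onP.
Qed.

Hypothesis w_ge0 : forall i, 0 <= w i.
Hypothesis w_sum : \sum_i w i = 1.

Lemma iid_total : \sum_(t : {ffun I -> T}) \prod_j w (t j) = 1.
Proof.
have := iid_all predT; rewrite w_sum expr1n; apply: etrans.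
by apply: eq_bigl => t; symmetry; apply/forallP.
Qed.

(** Pointwise, [f] is at least [V], minus [V - W] if no sample equals [o], minus [W] if all samples
    lie in [G]. The first event has probability at most [1 - w o], already because of a single
    sample. *)
Lemma iid_expect_ge (o : T) (G : pred T) (V W : R) (f : {ffun I -> T} -> R) :
    (0 < #|I|)%N -> 0 <= W <= V -> (forall t, 0 <= f t) ->
    (forall t j, t j = o -> V <= f t) ->
    (forall t j, ~~ G (t j) -> W <= f t) ->
  W + (V - W) * w o - W * (\sum_(i | G i) w i) ^+ #|I| <=
  \sum_(t : {ffun I -> T}) (\prod_j w (t j)) * f t.
Proof.
move=> I0 /andP[W0 WV] f0 fV fW.
set wt := fun t : {ffun I -> T} => \prod_j w (t j).
have wt0 t : 0 <= wt t by apply: prodr_ge0.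
have miss : \sum_(t : {ffun I -> T} | [forall j, t j != o]) wt t <= 1 - w o.
  rewrite (iid_all (fun i => i != o)).
  have -> : \sum_(i | i != o) w i = 1 - w o.
    by rewrite -w_sum [in RHS](bigD1 o) //= addrC addrK.
  have wo1 : w o <= 1 by rewrite -w_sum (bigD1 o) //= lerDl sumr_ge0.
  have wo := w_ge0 o.
  by rewrite -(prednK I0) exprS ler_piMr ?exprn_ile1 //; lra.
rewrite -(iid_all G).
have E : \sum_(t : {ffun I -> T}) (wt t * V - (V - W) * (if [forall j, t j != o] then wt t else 0)
    - W * (if [forall j, G (t j)] then wt t else 0)) <= \sum_t wt t * f t.
  apply: ler_sum => t _; have wtt := wt0 t.
  case: ifPn => [No|/forallPn[j /negPn/eqP tj]]; last first.
    have := ler_wpM2l wtt (fV _ _ tj); case: ifP => _; nra.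
  case: ifPn => [Gt|/forallPn[j Gj]].
    have := mulr_ge0 wtt (f0 t); nra.
  have := ler_wpM2l wtt (fW _ _ Gj); nra.
apply: le_trans E.
rewrite !sumrB -mulr_suml -!mulr_sumr -!big_mkcond /= iid_total mul1r.
have VW : 0 <= V - W by lra.
have := ler_wpM2l VW miss.
nra.
Qed.

End IidSample.

(** * Clustering cost, optimum and sampling probabilities *)

Section Cost.
Context {R : realType} {d : nat}.
Implicit Types (y c : 'rV[R]_d) (C : seq 'rV[R]_d).

Lemma sqdist_ge0 y c : 0 <= sqdist y c.
Proof. by apply: sumr_ge0 => i _; apply: sqr_ge0. Qed.

Lemma phi_pt_le y c C : c \in C -> phi_pt y C <= sqdist y c.
Proof.
case: C => //= c0 C; rewrite inE => /predU1P[->|].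
  by elim: C => //= c1 C IH; rewrite ge_min IH orbT.
by elim: C => //= c1 C IH; rewrite inE ge_min => /predU1P[->|/IH ->]; rewrite ?lexx ?orbT.
Qed.

Lemma phi_pt_ge (x : R) y C : C != [::] ->
  (forall c, c \in C -> x <= sqdist y c) -> x <= phi_pt y C.
Proof.
case: C => //= c0 C _; elim: C => [|c1 C IH] /= Hx; first by apply: Hx; rewrite inE.
rewrite le_min Hx ?inE ?eqxx ?orbT //=; apply: IH => c cC; apply: Hx.
by move: cC; rewrite !inE => /orP[->|->]; rewrite ?orbT.
Qed.

Lemma phi_pt_ge0 y C : 0 <= phi_pt y C.
Proof.
by case: C => [|c C] //; apply: phi_pt_ge => // ? _; apply: sqdist_ge0.
Qed.

Lemma phi_set_Xs n (X : 'I_n -> 'rV[R]_d) C :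
  phi_set (Xs X) C = \sum_i phi_pt (X i) C.
Proof. by rewrite /phi_set /Xs big_map big_enum. Qed.

Lemma phi_set_ge0 (Y C : seq 'rV[R]_d) : 0 <= phi_set Y C.
Proof. by apply: sumr_ge0 => y _; apply: phi_pt_ge0. Qed.

Lemma OPT_le k (Y C : seq 'rV[R]_d) :
  uniq C -> size C = k -> OPT k Y <= phi_set Y C.
Proof.
move=> uC sC; apply: ge_inf; last by exists C.
by exists 0 => _ [D _ <-]; apply: phi_set_ge0.
Qed.

(* Points whose squared distance to [C] is below [x] have distinct nearest
   centers, and there are more points than centers. *)
Lemma OPT_ge n k (X : 'I_n -> 'rV[R]_d) (x : R) C0 :
    (0 < k < n)%N -> uniq C0 -> size C0 = k ->
    (forall i j c, i != j -> sqdist (X i) c < x -> x <= sqdist (X j) c) ->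
  x <= OPT k (Xs X).
Proof.
move=> /andP[k0 kn] uC0 sC0 sepX; apply: lb_le_inf; first by eexists; exists C0.
move=> _ [C [uC sC] <-].
have Cn : C != [::] by rewrite -size_eq0 sC -lt0n.
have [[i xi]|/forallNP near] := pselect (exists i, x <= phi_pt (X i) C).
  rewrite phi_set_Xs (bigD1 i) //= (le_trans xi) // lerDl.
  by apply: sumr_ge0 => *; apply: phi_pt_ge0.
have nearC i : exists c, c \in C /\ sqdist (X i) c < x.
  apply: contrapT => /forallNP no; apply: (near i); apply: phi_pt_ge => // c cC.
  by rewrite leNgt; apply/negP => cx; apply: (no c).
have [g gP] := choice nearC.
have inj_g : injective g.
  move=> i j gij; apply/eqP/negPn/negP => /sepX /(_ (gP i).2).
  by rewrite gij leNgt (gP j).2.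
suff : (n <= k)%N by rewrite leqNgt kn.
rewrite -sC -(size_enum_ord n) -(size_map g); apply: uniq_leq_size.
  by rewrite map_inj_uniq ?enum_uniq.
by move=> _ /mapP[i _ ->]; apply: (gP i).1.
Qed.

Lemma d2prob_ge0 n (X : 'I_n -> 'rV[R]_d) C i : 0 <= d2prob X C i.
Proof.
rewrite /d2prob; case: ifP => _; last by rewrite invr_ge0.
by rewrite divr_ge0 ?phi_pt_ge0 ?phi_set_ge0.
Qed.

Lemma sum_d2prob n (X : 'I_n -> 'rV[R]_d) C :
  (0 < n)%N -> \sum_i d2prob X C i = 1.
Proof.
move=> n0; rewrite /d2prob /=; case: (ltP 0 (phi_set (Xs X) C)) => t0.
  by rewrite -mulr_suml -phi_set_Xs divff ?gt_eqF.
by rewrite sumr_const card_ord -[LHS]mulr_natl divff // pnatr_eq0 -lt0n.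
Qed.

End Cost.

(** * Rules that seek one point and avoid a set *)

Section PreferenceRule.
Context {R : realType} {d l : nat}.
Variables (o : 'rV[R]_d) (G : pred 'rV[R]_d) (j0 : 'I_l).

Definition preferred (t : {ffun 'I_l -> 'rV[R]_d}) : 'I_l :=
  if [pick j | t j == o] is Some j then j
  else if [pick j | ~~ G (t j)] is Some j then j else j0.

Definition preference_rule : rule R d l := fun _ t j => (preferred t == j)%:R.

Lemma preference_ruleP : is_rule preference_rule.
Proof.
split=> [C t j|C t|//]; first by rewrite /preference_rule.
rewrite /preference_rule (bigD1 (preferred t)) //= eqxx big1 ?addr0 // => j.
by rewrite eq_sym => /negPf ->.
Qed.

Lemma preferred_eq (t : {ffun 'I_l -> 'rV[R]_d}) j : t j = o -> t (preferred t) = o.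
Proof.
rewrite /preferred => tj; case: pickP => [i /eqP //|/(_ j)].
by rewrite tj eqxx.
Qed.

Lemma preferred_notin (t : {ffun 'I_l -> 'rV[R]_d}) j :
  ~~ G o -> ~~ G (t j) -> ~~ G (t (preferred t)).
Proof.
rewrite /preferred => Go Gj; case: pickP => [i /eqP -> //|_].
by case: pickP => // /(_ j); rewrite Gj.
Qed.

Variables (n : nat) (X : 'I_n -> 'rV[R]_d) (E : seq 'rV[R]_d -> bool).
Let succ := succ_prob X preference_rule E.
Hypothesis n_gt0 : (0 < n)%N.

Lemma succ_prob_ge0 m C : 0 <= succ m C.
Proof.
elim: m C => [|m IH] C /=; first by rewrite /succ /=; case: ifP.
apply: sumr_ge0 => t _; apply: mulr_ge0.
  by apply: prodr_ge0 => j _; apply: d2prob_ge0.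
by apply: sumr_ge0 => j _; rewrite mulr_ge0 // /preference_rule.
Qed.

(** The one-step recursion behind all later bounds; a pick inside [G] is counted as failure. The
    rule is deterministic, so the inner sum over candidates has one nonzero term. *)
Lemma succ_prob_ge (io : 'I_n) (V W : R) m C :
    X io = o -> ~~ G o -> 0 <= W <= V ->
    V <= succ m (rcons C o) ->
    (forall i, ~~ G (X i) -> W <= succ m (rcons C (X i))) ->
  W + (V - W) * d2prob X C io
    - W * (\sum_(i | G (X i)) d2prob X C i) ^+ l <= succ m.+1 C.
Proof.
move=> Xo Go WV HV HW.
pose nxt (t : {ffun 'I_l -> 'I_n}) :=
  succ m (rcons C (X (t (preferred [ffun j => X (t j)])))).
have -> : succ m.+1 C =
    \sum_(t : {ffun 'I_l -> 'I_n}) (\prod_j d2prob X C (t j)) * nxt t.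
  apply: eq_bigr => t _; congr (_ * _); rewrite /nxt /preference_rule.
  rewrite (bigD1 (preferred [ffun j => X (t j)])) //= eqxx mul1r big1 ?addr0 //.
  by move=> j; rewrite eq_sym => /negPf ->; rewrite mul0r.
have l0 : (0 < l)%N by apply: leq_ltn_trans (ltn_ord j0).
rewrite -[X in _ ^+ X]card_ord; apply: iid_expect_ge; rewrite ?card_ord //.
- by move=> i; apply: d2prob_ge0.
- exact: sum_d2prob.
- by move=> t; apply: succ_prob_ge0.
- move=> t j tj; rewrite /nxt.
  have /preferred_eq : [ffun j => X (t j)] j = o by rewrite ffunE tj.
  by rewrite ffunE => ->.
- move=> t j Gj; apply: HW.
  have /(preferred_notin Go) : ~~ G ([ffun j => X (t j)] j) by rewrite ffunE.
  by rewrite ffunE.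
Qed.

End PreferenceRule.

(** All centers are input points, possibly repeated. With [G] empty and [V = W = 1] no step loses
    probability. *)
Lemma kmpp_prob_sure (R : realType) (d l n k : nat) (X : 'I_n -> 'rV[R]_d)
    (io : 'I_n) (j0 : 'I_l) (E : seq 'rV[R]_d -> bool) :
    (forall s, size s = k -> E (map X s)) ->
  1 <= kmpp_prob X (preference_rule (X io) pred0 j0) k E.
Proof.
move=> HE.
suff sure m s : (size s + m = k)%N ->
    1 <= succ_prob X (preference_rule (X io) pred0 j0) E m (map X s).
  exact: (sure k [::]).
elim: m s => [|m IH] s sz; first by rewrite /= HE // -sz addn0.
have n0 : (0 < n)%N by apply: leq_ltn_trans (ltn_ord io).
have l0 : (0 < l)%N by apply: leq_ltn_trans (ltn_ord j0).
have next i : 1 <= succ_prob X (preference_rule (X io) pred0 j0) E m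
                    (rcons (map X s) (X i)).
  by rewrite -map_rcons IH // size_rcons addSnnS.
have := @succ_prob_ge _ _ _ _ pred0 j0 _ _ E n0 io 1 1 m (map X s) erefl isT.
rewrite ler01 lexx => /(_ _ isT (next io) (fun i _ => next i)).
by rewrite big_pred0_eq expr0n gtn_eqF // subrr mul0r mulr0 addr0 subr0.
Qed.

(** * Points on distinct coordinate axes *)

Section OrthogonalPoints.
Context {R : realType} {n : nat}.
Variable a : 'I_n -> R.

Definition axis_pt (i : 'I_n) : 'rV[R]_n := a i *: delta_mx 0 i.

Lemma axis_ptE i j : axis_pt i 0 j = if i == j then a i else 0.
Proof.
rewrite !mxE eqxx /= eq_sym.
by case: eqP => _; rewrite ?mulr1 ?mulr0.
Qed.

Lemma sqdist_axis0 i : sqdist (axis_pt i) 0 = a i ^+ 2.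
Proof.
rewrite /sqdist (bigD1 i) //= axis_ptE eqxx mxE subr0 big1 ?addr0 // => j ji.
by rewrite axis_ptE eq_sym (negPf ji) mxE subr0 expr0n.
Qed.

Lemma sqdist_axis i j :
  sqdist (axis_pt i) (axis_pt j) = if i == j then 0 else a i ^+ 2 + a j ^+ 2.
Proof.
have [<-|ij] := eqVneq i j.
  by rewrite /sqdist big1 // => ? _; rewrite subrr expr0n.
rewrite /sqdist (bigD1 i) //= (bigD1 j) /=; last by rewrite eq_sym.
rewrite !axis_ptE !eqxx [j == i]eq_sym (negPf ij) subr0 sub0r sqrrN.
rewrite big1 ?addr0 // => h /andP[hi hj].
by rewrite !axis_ptE eq_sym (negPf hi) eq_sym (negPf hj) subr0 expr0n.
Qed.

Lemma sqdist_axis_le i j : sqdist (axis_pt i) (axis_pt j) <= a i ^+ 2 + a j ^+ 2.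
Proof.
by rewrite sqdist_axis; case: ifP => _; rewrite ?addr_ge0 ?sqr_ge0.
Qed.

Lemma phi_pt_axis_le i j s : j \in s ->
  phi_pt (axis_pt i) (map axis_pt s) <= a i ^+ 2 + a j ^+ 2.
Proof.
move=> js; apply: le_trans (sqdist_axis_le i j).
by apply: phi_pt_le; apply: map_f.
Qed.

Lemma phi_pt_axis_ge (b : R) i s : s != [::] -> i \notin s -> 0 <= b ->
    (forall j, j \in s -> b <= a j) ->
  a i ^+ 2 + b ^+ 2 <= phi_pt (axis_pt i) (map axis_pt s).
Proof.
move=> s0 si b0 sb; apply: phi_pt_ge; first by case: s s0 {si sb}.
move=> _ /mapP[j js ->]; rewrite sqdist_axis ifN; last first.
  by apply: contraNneq si => ->.
by rewrite lerD2l ler_pXn2r ?nnegrE ?sb // (le_trans b0) ?sb.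
Qed.

Lemma axis_pt_inj : (forall i, 0 < a i) -> injective axis_pt.
Proof.
move=> a0 i j eij; apply/eqP/negPn/negP => ij.
have := sqdist_axis i j; rewrite eij (negPf ij) sqdist_axis eqxx.
by have := exprn_gt0 2 (a0 i); have := exprn_gt0 2 (a0 j); lra.
Qed.

(** Coordinate [i] suffices: it is at least [e] at one point and 0 at the other, so [c] is at least
    [e / 2] away from one of them. *)
Lemma axis_pt_sep (e : R) i j c : 0 <= e -> e <= a i -> i != j ->
  sqdist (axis_pt i) c < e ^+ 2 / 4 -> e ^+ 2 / 4 <= sqdist (axis_pt j) c.
Proof.
move=> e0 ei ij; rewrite ltNge; apply: contraNle => cj.
have coord (y : 'rV[R]_n) : (y 0 i - c 0 i) ^+ 2 <= sqdist y c.
  rewrite /sqdist (bigD1 i) //= lerDl sumr_ge0 // => *; exact: sqr_ge0.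
have := coord (axis_pt i); have := coord (axis_pt j).
rewrite !axis_ptE eqxx [j == i]eq_sym (negPf ij) sub0r sqrrN.
have e2 : e ^+ 2 <= a i ^+ 2 by rewrite ler_pXn2r ?nnegrE // (le_trans e0).
have := sqr_ge0 (2 * c 0 i - a i).
nra.
Qed.

End OrthogonalPoints.

(** * Counting indices inside and outside the core *)

Lemma sum_ord_ge (V : nmodType) k M (F : 'I_(k + M) -> V) :
  \sum_(i < k + M | (k <= i)%N) F i = \sum_(i < M) F (rshift k i).
Proof.
rewrite big_split_ord /= big_pred0 ?add0r.
  by apply: eq_bigl => i /=; rewrite leq_addr.
by move=> i /=; rewrite leqNgt ltn_ord.
Qed.

Lemma card_unhit k M (s : seq 'I_(k + M)) :
  (k <= #|[pred i : 'I_(k + M) | (i < k)%N & i \notin s]| + size s)%N.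
Proof.
have /leq_trans : (k <= #|[pred i : 'I_(k + M) | (i < k)%N]|)%N.
  rewrite -[X in (X <= _)%N]card_ord -(fintype.card_image (@lshift_inj k M)).
  by apply/subset_leq_card/fintype.subsetP => _ /fintype.imageP[i _ ->]; rewrite inE /=.
apply; rewrite -(cardID (mem s)) addnC leq_add //.
  by apply/subset_leq_card/fintype.subsetP => i; rewrite !inE andbC.
apply: leq_trans (card_size s).
by apply/subset_leq_card/fintype.subsetP => i; rewrite !inE => /andP[].
Qed.

(** * The instance *)

Section Instance.
Context {R : realType}.
Variables k M l : nat.
Hypotheses (k_ge2 : (2 <= k)%N) (M_gt0 : (0 < M)%N) (M_le : (M <= k)%N).
Variable j0 : 'I_l.
Implicit Types (i : 'I_(k + M)) (s : seq 'I_(k + M)).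

(** Chosen so that a loss of [delta] per step over at most [k] steps adds up to at most 1/2. *)
Definition delta : R := (2 * k%:R)^-1.

(* The first [k - 1] points are remote singletons, the point of index [k - 1]
   is the bad center of the remaining cluster, and the last [M] points form its
   tight core. *)
Definition scale (i : 'I_(k + M)) : R :=
  if (i.+1 < k)%N then 1 else if (i < k)%N then delta else delta / M%:R.

Definition X := axis_pt scale.

Lemma bad_subproof : (k.-1 < k + M)%N.
Proof. lia. Qed.

Definition bad : 'I_(k + M) := Ordinal bad_subproof.

Lemma bad_succ : bad.+1 = k.
Proof. by rewrite /= prednK // ltnW. Qed.

Lemma far_of_notbad i : (i < k)%N -> i != bad -> (i.+1 < k)%N.
Proof. by rewrite -(inj_eq val_inj) /=; lia. Qed.

Lemma bad_lt : (bad < k)%N.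
Proof. by have := bad_succ; lia. Qed.

(** Stated on points, since a rule sees points and not indices. *)
Definition core (p : 'rV[R]_(k + M)) : bool :=
  [exists i : 'I_(k + M), (k <= i)%N && (p == X i)].

Lemma k_ge2R : 2 <= k%:R :> R. Proof. by rewrite ler_nat. Qed.
Lemma M_ge1R : 1 <= M%:R :> R. Proof. by rewrite ler1n. Qed.
Lemma M_leR : M%:R <= k%:R :> R. Proof. by rewrite ler_nat. Qed.

Lemma delta_gt0 : 0 < delta.
Proof. by rewrite invr_gt0; have := k_ge2R; lra. Qed.

Lemma delta_le1 : delta <= 1.
Proof. by rewrite invf_le1; have := k_ge2R; lra. Qed.

Lemma delta_k : 2 * k%:R * delta = 1.
Proof. by rewrite divff //; have := k_ge2R; lra. Qed.

Lemma eps_gt0 : 0 < delta / M%:R.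
Proof. by rewrite divr_gt0 ?delta_gt0 // ltr0n. Qed.

Lemma eps_M : delta / M%:R * M%:R = delta.
Proof. by rewrite divfK // pnatr_eq0 -lt0n. Qed.

Lemma eps_le_delta : delta / M%:R <= delta.
Proof. by rewrite ler_piMr ?invf_le1 ?ltr0n ?M_ge1R // ltW ?delta_gt0. Qed.

Lemma eps_le_scale i : delta / M%:R <= scale i.
Proof.
rewrite /scale; have := eps_le_delta; have := delta_le1.
by case: ifP => _; [lra | case: ifP].
Qed.

Lemma scale_gt0 i : 0 < scale i.
Proof. exact: lt_le_trans eps_gt0 (eps_le_scale i). Qed.

Lemma scale_le1 i : scale i <= 1.
Proof.
rewrite /scale; have := eps_le_delta; have := delta_le1.
by case: ifP => _ //; case: ifP => _; lra.
Qed.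

Lemma scale_far i : (i.+1 < k)%N -> scale i = 1.
Proof. by rewrite /scale => ->. Qed.

Lemma scale_core i : (k <= i)%N -> scale i = delta / M%:R.
Proof. by move=> ki; rewrite /scale !ltnNge leqW ?ki. Qed.

Lemma scale_bad : scale bad = delta.
Proof. by rewrite /scale /= prednK ?ltnn ?leqnn //; lia. Qed.

Lemma delta_le_scale i : (i < k)%N -> delta <= scale i.
Proof. by move=> ik; rewrite /scale ik; case: ifP => _ //; exact: delta_le1. Qed.

Lemma X_inj : injective X.
Proof. exact: axis_pt_inj scale_gt0. Qed.

Lemma coreX i : core (X i) = (k <= i)%N.
Proof.
apply/existsP/idP => [[j /andP[kj /eqP/X_inj -> //]]|ki].
by exists i; rewrite ki eqxx.
Qed.

Lemma bad_notin_core : ~~ core (X bad).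
Proof. by rewrite coreX -ltnNge bad_lt. Qed.

(** * Bounds on the optimum *)

Lemma OPT_X_gt0 : 0 < OPT k (Xs X).
Proof.
apply: lt_le_trans (_ : (delta / M%:R) ^+ 2 / 4 <= _).
  by rewrite divr_gt0 ?exprn_gt0 ?eps_gt0.
(* A witness that the infimum is not over the empty set. *)
pose C0 := map X (map (lshift M) (enum 'I_k)).
apply: (@OPT_ge _ _ _ _ _ _ C0).
- lia.
- rewrite map_inj_uniq; last exact: X_inj.
  by rewrite map_inj_uniq ?enum_uniq //; exact: lshift_inj.
- by rewrite size_map size_map size_enum_ord.
- move=> i j c ij; apply: axis_pt_sep => //; first exact: ltW eps_gt0.
  exact: eps_le_scale.
Qed.

(** The origin serves the cluster: the bad point pays [delta ^ 2], the core
    [M * (delta / M) ^ 2 <= delta ^ 2]. The [k - 1] far points are their own centers. *)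
Lemma OPT_X_le : OPT k (Xs X) <= 2 * delta ^+ 2.
Proof.
have kM : (k.-1 <= k + M)%N by lia.
pose far := map X (map (widen_ord kM) (enum 'I_k.-1)).
have u0 : (0 : 'rV[R]_(k + M)) \notin far.
  apply/negP => /mapP[i _ /(congr1 (fun p : 'rV[R]__ => p 0 i))].
  by rewrite axis_ptE eqxx mxE; have := scale_gt0 i; lra.
have [C defC] : exists C, C = 0 :: far by exists (0 :: far).
apply: le_trans (_ : phi_set (Xs X) C <= _).
  rewrite defC; apply: OPT_le => /=; last by rewrite size_map size_map size_enum_ord; lia.
  rewrite u0 map_inj_uniq; last exact: X_inj.
  by rewrite map_inj_uniq ?enum_uniq // => i j /(congr1 val) /= /val_inj.
have cost0 i : phi_pt (X i) C <= scale i ^+ 2.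
  by rewrite -sqdist_axis0; apply: phi_pt_le; rewrite defC inE eqxx.
rewrite phi_set_Xs (bigID (fun i : 'I_(k + M) => (k <= i)%N)) /=.
rewrite [in X in _ + X](bigD1 bad) /=; last by rewrite -ltnNge bad_lt.
rewrite [X in _ + (_ + X)]big1 ?addr0; last first.
  move=> i /andP[]; rewrite -ltnNge => ik ib; apply/eqP.
  have ik1 : (i < k.-1)%N by have := far_of_notbad ik ib; lia.
  rewrite eq_le phi_pt_ge0 andbT.
  have Xi : X i \in C.
    rewrite defC inE; apply/orP; right; apply: map_f; apply/mapP.
    by exists (Ordinal ik1); [rewrite mem_enum | apply: val_inj].
  by apply: le_trans (phi_pt_le _ Xi) _; rewrite sqdist_axis eqxx.
have bd := cost0 bad; rewrite scale_bad in bd.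
have : \sum_(i < k + M | (k <= i)%N) phi_pt (X i) C <=
       \sum_(i < k + M | (k <= i)%N) (delta / M%:R) ^+ 2.
  by apply: ler_sum => i /scale_core <-.
rewrite [X in _ <= X]sum_ord_ge sumr_const card_ord -[X in _ <= X]mulr_natr.
have := eps_M; have := eps_le_delta; have := eps_gt0.
nra.
Qed.

(** * Costs and sampling probabilities during the run *)

Lemma phi_set_X_ge s : s != [::] -> all (fun i : 'I__ => (i < k)%N) s ->
  M%:R * delta ^+ 2 <= phi_set (Xs X) (map X s).
Proof.
move=> s0 /allP sk; rewrite phi_set_Xs (bigID (fun i : 'I_(k + M) => (k <= i)%N)) /=.
apply: le_trans (_ : \sum_(i < k + M | (k <= i)%N) delta ^+ 2 <= _).
  by rewrite sum_ord_ge sumr_const card_ord mulr_natl.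
rewrite -[X in X <= _]addr0 lerD ?sumr_ge0 // => [|i _]; last exact: phi_pt_ge0.
apply: ler_sum => i ki; apply: le_trans (phi_pt_axis_ge (b := delta) s0 _ _ _).
- by rewrite lerDr sqr_ge0.
- by apply: contraL ki => /sk; rewrite -ltnNge.
- exact: ltW delta_gt0.
- by move=> j /sk; apply: delta_le_scale.
Qed.

(** Some point is not a center and pays at least its squared scale. For [M = 1] this is already
    [delta ^ 2]. *)
Lemma phi_set_X_ge_eps s : s != [::] -> (size s <= k)%N ->
  (delta / M%:R) ^+ 2 <= phi_set (Xs X) (map X s).
Proof.
move=> s0 sk; have /card_gt0P[i] : (0 < #|[predC mem s]|)%N.
  rewrite -(ltn_add2l #|s|) addn0 (cardC (mem s)) card_ord.
  apply: leq_ltn_trans (leq_trans (card_size s) sk) _.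
  by rewrite -[ltnLHS]addn0 ltn_add2l.
rewrite inE /= => si; rewrite phi_set_Xs (bigD1 i) //=; apply: ler_wpDr.
  by apply: sumr_ge0 => *; apply: phi_pt_ge0.
apply: le_trans (phi_pt_axis_ge (b := 0) s0 si _ _) => // [|j _].
  rewrite expr0n addr0 ler_pXn2r ?nnegrE ?eps_le_scale //.
    exact: ltW eps_gt0.
  exact: ltW (scale_gt0 i).
exact: ltW (scale_gt0 j).
Qed.

Lemma d2prob_pos s i : 0 < phi_set (Xs X) (map X s) ->
  d2prob X (map X s) i = phi_pt (X i) (map X s) / phi_set (Xs X) (map X s).
Proof. by rewrite /d2prob => ->. Qed.

(** Some far point is unhit and keeps the total cost at least 1, while the bad center serves each
    core point at cost at most [2 * delta ^ 2]. *)
Lemma core_prob_after_bad s :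
    all (fun i : 'I__ => (i < k)%N) s -> bad \in s -> (size s < k)%N ->
  \sum_(i < k + M | (k <= i)%N) d2prob X (map X s) i <= delta.
Proof.
move=> sk sb sz.
have /card_gt0P[i] : (0 < #|[pred i : 'I_(k + M) | (i < k)%N & i \notin s]|)%N.
  by have := card_unhit s; lia.
rewrite inE => /andP[ik si].
have s0 : s != [::] by case: (s) sb.
have far1 : 1 <= phi_set (Xs X) (map X s).
  rewrite phi_set_Xs (bigD1 i) //=; apply: ler_wpDr.
    by apply: sumr_ge0 => *; apply: phi_pt_ge0.
  apply: le_trans (phi_pt_axis_ge (b := delta) s0 si _ _).
  - rewrite scale_far ?expr1n ?lerDl ?sqr_ge0 //.
    by apply: far_of_notbad => //; apply: contraNneq si => ->.
  - exact: ltW delta_gt0.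
  - by move=> j /(allP sk); apply: delta_le_scale.
have D0 := lt_le_trans ltr01 far1.
apply: le_trans (_ : \sum_(i < k + M | (k <= i)%N) 2 * delta ^+ 2 <= _).
  apply: ler_sum => h kh; rewrite d2prob_pos // ler_pdivrMr //.
  have := phi_pt_axis_le scale h sb; rewrite scale_core // scale_bad.
  have e2 : (delta / M%:R) ^+ 2 <= delta ^+ 2.
    by rewrite ler_pXn2r ?nnegrE ?eps_le_delta ?ltW ?eps_gt0 ?delta_gt0.
  by have := sqr_ge0 delta; rewrite -/X; nra.
rewrite sum_ord_ge sumr_const card_ord -[X in X <= _]mulr_natr.
by have := delta_k; have := delta_gt0; have := M_leR; nra.
Qed.

(** Once a far center exists, a core point pays at most [1 + e ^ 2], and each of the at least
    [k / 2] unhit points outside the core pays no less. The bad point pays at least 1 out of a total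
    of at most [2 * (k + M) <= 4 * k]. *)
Lemma phase1_probs s : all (fun i : 'I__ => (i.+1 < k)%N) s ->
    (2 * size s <= k)%N ->
  \sum_(i < k + M | (k <= i)%N) d2prob X (map X s) i <= 2 * M%:R / k%:R /\
  (4 * k%:R)^-1 <= d2prob X (map X s) bad.
Proof.
move=> /allP sfar sz.
have k2 := k_ge2R; have M1 := M_ge1R; have Mk := M_leR.
have k0 : 0 < k%:R :> R by lra.
have [s0|s0] := eqVneq s [::].
  (* Without centers [phi_pt] is 0 by convention, so the draw is uniform. *)
  have d0 i : d2prob X (map X s) i = (k%:R + M%:R)^-1.
    rewrite /d2prob s0 /= /phi_set big1_seq ?ltxx ?natrD //.
  under eq_bigr do rewrite d0.
  rewrite sum_ord_ge sumr_const card_ord d0 -[X in X <= _]mulr_natr mulrC; split.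
    rewrite ler_pdivrMr; last lra.
    by rewrite mulrAC ler_pdivlMr //; nra.
  by rewrite lef_pV2 ?posrE; lra.
set e := delta / M%:R.
have ege i : (i < k)%N -> i \notin s -> 1 + e ^+ 2 <= phi_pt (X i) (map X s).
  move=> ik si; apply: le_trans (phi_pt_axis_ge (b := 1) s0 si _ _) => //.
    rewrite expr1n addrC lerD2r ler_pXn2r ?nnegrE ?eps_le_scale //.
      exact: ltW eps_gt0.
    exact: ltW (scale_gt0 i).
  by move=> j /sfar /scale_far ->.
have [j js] : exists j, j \in s by case: (s) s0 => // j s' _; exists j; rewrite inE eqxx.
set D := phi_set (Xs X) (map X s).
set S := \sum_(i < k + M | (k <= i)%N) phi_pt (X i) (map X s).
have Sle : S <= M%:R * (1 + e ^+ 2).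
  apply: le_trans (_ : \sum_(i < k + M | (k <= i)%N) (1 + e ^+ 2) <= _); last first.
    by rewrite sum_ord_ge sumr_const card_ord mulr_natl.
  apply: ler_sum => i ki; have := phi_pt_axis_le scale i js.
  by rewrite scale_core // (scale_far (sfar _ js)) expr1n addrC.
pose U := [pred i : 'I_(k + M) | (i < k)%N & i \notin s].
have Ule : k%:R <= 2 * #|U|%:R :> R.
  by rewrite -natrM ler_nat; have := card_unhit s; rewrite -/U; lia.
have Dge : S + #|U|%:R * (1 + e ^+ 2) <= D.
  rewrite /D phi_set_Xs (bigID (fun i : 'I_(k + M) => (k <= i)%N)) /= lerD2l.
  rewrite (bigID (fun i => i \in s)) /=; apply: ler_wpDl.
    by apply: sumr_ge0 => *; apply: phi_pt_ge0.
  rewrite mulr_natl -sumr_const.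
  rewrite (eq_bigl (mem U)); last by move=> i; rewrite !inE -ltnNge.
  by apply: ler_sum => i /andP[ik si]; apply: ege.
have Dle : D <= 4 * k%:R.
  rewrite /D phi_set_Xs.
  apply: le_trans (_ : \sum_(i < k + M) (2 : R) <= _); last first.
    by rewrite sumr_const card_ord -[X in X <= _]mulr_natr natrD; lra.
  apply: ler_sum => i _; have := phi_pt_axis_le scale i js.
  rewrite (scale_far (sfar _ js)) expr1n.
  have := exprn_ile1 2 (ltW (scale_gt0 i)) (scale_le1 i); rewrite -/X; lra.
have S0 : 0 <= S by apply: sumr_ge0 => *; apply: phi_pt_ge0.
have e20 := sqr_ge0 e.
have U0 : 0 <= #|U|%:R :> R by [].
have M0 : 0 <= M%:R :> R by [].
have D0 : 0 < D by have := mulr_ge0 U0 e20; lra.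
split.
  under eq_bigr do rewrite d2prob_pos //.
  rewrite -mulr_suml -/S -/D ler_pdivrMr // mulrAC ler_pdivlMr //.
  (* With [u] the size of [U]: [S * k <= 2 * S * u <= 2 * M * u * (1 + e ^ 2) <= 2 * M * D]. *)
  apply: le_trans (ler_wpM2l S0 Ule) _.
  have := ler_wpM2r U0 Sle; have := ler_wpM2l M0 Dge.
  have := mulr_ge0 M0 S0; lra.
rewrite d2prob_pos // -/D ler_pdivlMr // mulrC ler_pdivrMr; last lra.
have phi_bad : 1 + e ^+ 2 <= phi_pt (X bad) (map X s).
  by apply: ege; [exact: bad_lt | apply/negP => /sfar; rewrite bad_succ ltnn].
apply: le_trans Dle _; rewrite ler_peMl //; lra.
Qed.

(** * Success probability after and before the bad point is picked *)

Variable E : seq 'rV[R]_(k + M) -> bool.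
Hypothesis E_no_core : forall s, size s = k ->
  all (fun i : 'I__ => (i < k)%N) s -> E (map X s).
Let rul := preference_rule (X bad) core j0.

(** Each remaining step hits the core with probability at most [Q ^ l <= Q <= delta]. All picks
    outside the core are equally good, hence [V = W]. *)
Lemma succ_after_bad m s :
    all (fun i : 'I__ => (i < k)%N) s -> bad \in s -> (size s + m = k)%N ->
  1 - m%:R * delta <= succ_prob X rul E m (map X s).
Proof.
elim: m s => [|m IH] s sk sb sz.
  by rewrite mul0r subr0 /= E_no_core //; lia.
have mk : m.+1%:R <= k%:R :> R by rewrite ler_nat; lia.
rewrite -natr1 in mk.
have dk := delta_k; have d0 := delta_gt0; have m0 : 0 <= m%:R :> R by [].
have next i : ~~ core (X i) ->
    1 - m%:R * delta <= succ_prob X rul E m (rcons (map X s) (X i)).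
  rewrite coreX -ltnNge -map_rcons => ik; apply: IH.
  - by rewrite all_rcons ik.
  - by rewrite mem_rcons inE sb orbT.
  - by rewrite size_rcons; lia.
have W01 : 0 <= 1 - m%:R * delta <= 1 - m%:R * delta by rewrite lexx andbT; nra.
have n0 : (0 < k + M)%N by lia.
have := succ_prob_ge n0 (erefl (X bad)) bad_notin_core W01
  (next _ bad_notin_core) next.
apply: le_trans; rewrite subrr mul0r addr0.
set Q := \sum_(i | _) _.
have Qd : Q <= delta.
  rewrite /Q; under eq_bigl do rewrite coreX.
  by apply: core_prob_after_bad => //; lia.
have Q0 : 0 <= Q by apply: sumr_ge0 => *; apply: d2prob_ge0.
have Ql : Q ^+ l <= Q.
  have l0 : (0 < l)%N by apply: leq_ltn_trans (ltn_ord j0).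
  rewrite -(prednK l0) exprS ler_piMr // exprn_ile1 //.
  by have := delta_le1; lra.
have Ql0 := exprn_ge0 l Q0.
rewrite -natr1; nra.
Qed.

Hypothesis M_small : (2 * M%:R / k%:R) ^+ l <= k%:R^-1 :> R.

(* Per step, the bad point is a candidate with probability at least [1 / (4 k)]
   and then leads to success with probability at least [1 / 2]; the rate
   [1 / (16 k)] leaves a factor 2 to absorb the event that the core is hit. *)
Lemma succ_before_bad j s : all (fun i : 'I__ => (i.+1 < k)%N) s ->
    (size s + j = k./2)%N ->
  j%:R / (16 * k%:R) <= succ_prob X rul E (j + (k - k./2)) (map X s).
Proof.
have k2 := k_ge2R; have k0 : 0 < k%:R :> R by lra.
have n0 : (0 < k + M)%N by lia.
elim: j s => [|j IH] s sfar sz.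
  by rewrite mul0r; apply: succ_prob_ge0.
have szh : (2 * size s <= k)%N by lia.
have jk2 : (2 * j.+1 <= k)%N by lia.
have jm : (j + (k - k./2) <= k)%N by lia.
have szm : ((size s).+1 + (j + (k - k./2)) = k)%N by lia.
have szj : ((size s).+1 + j = k./2)%N by lia.
have [] := phase1_probs sfar szh.
set Q := \sum_(i | _) _; set p := d2prob X _ bad => Qle pge.
have Q0 : 0 <= Q by apply: sumr_ge0 => *; apply: d2prob_ge0.
have hl : Q ^+ l <= k%:R^-1.
  by apply: le_trans M_small; apply: lerXn2r; rewrite ?nnegrE // (le_trans Q0).
have jk : 2 * (j%:R + 1) <= k%:R :> R.
  by rewrite natr1 -natrM ler_nat.
pose W : R := j%:R / (16 * k%:R).
have kV : k%:R * k%:R^-1 = 1 :> R by rewrite divff //; lra.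
have WE : W = j%:R * k%:R^-1 / 16 by rewrite /W invfM; lra.
have p4 : (4 * k%:R)^-1 = k%:R^-1 / 4 :> R by rewrite invfM; lra.
have j0' : 0 <= j%:R :> R by [].
have kV0 : 0 < k%:R^-1 :> R by rewrite invr_gt0.
have jV : j%:R * k%:R^-1 <= 1 / 2 :> R by nra.
have W0 : 0 <= W <= 1 / 2 by rewrite WE; apply/andP; split; nra.
have sk : all (fun i : 'I__ => (i < k)%N) s.
  by apply: sub_all sfar => i; apply: leq_trans.
have HV : 1 / 2 <= succ_prob X rul E (j + (k - k./2)) (rcons (map X s) (X bad)).
  rewrite -map_rcons; apply: le_trans (succ_after_bad (m := j + (k - k./2)) _ _ _).
  - have : (j + (k - k./2))%:R <= k%:R :> R by rewrite ler_nat.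
    by have := delta_k; have := delta_gt0; nra.
  - by rewrite all_rcons sk andbT bad_lt.
  - by rewrite mem_rcons inE eqxx.
  - by rewrite size_rcons.
have HW i : ~~ core (X i) ->
    W <= succ_prob X rul E (j + (k - k./2)) (rcons (map X s) (X i)).
  have [-> _|ib] := eqVneq i bad; first by apply: le_trans HV; case/andP: W0.
  rewrite coreX -ltnNge -map_rcons => ik; apply: IH.
    by rewrite all_rcons sfar andbT; apply: far_of_notbad.
  by rewrite size_rcons.
have := succ_prob_ge n0 (erefl (X bad)) bad_notin_core W0 HV HW.
apply: le_trans; under [X in X ^+ l]eq_bigl do rewrite coreX.
rewrite -/Q -/p -natr1 mulrDl -/W mul1r.
case/andP: W0 => W0 W1.
have -> : (16 * k%:R)^-1 = k%:R^-1 / 16 :> R by rewrite invfM; lra.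
rewrite p4 in pge.
have := ler_wpM2l W0 hl.
have VW : 0 <= 1 / 2 - W by lra.
have := ler_wpM2l VW pge.
(* The gain of this step is at least [(15 / 32) / (4 * k) - (1 / 32) / k = 11 / (128 * k)], above
   [1 / (16 * k)]. *)
have : W <= 1 / 32 by rewrite WE; lra.
nra.
Qed.

Lemma kmpp_prob_X_ge : 1 / 48 <= kmpp_prob X rul k E.
Proof.
have k2 := k_ge2R.
have := @succ_before_bad k./2 [::] isT erefl.
rewrite subnKC; last by lia.
apply: le_trans; rewrite ler_pdivlMr; last by lra.
(* Tight at [k = 3]; with the rate [1 / (16 * k)] it yields 1/48. *)
have : k%:R <= 3 * k./2%:R :> R by rewrite -natrM ler_nat; lia.
lra.
Qed.

End Instance.

(** * Choice of [M] and the final bound *)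

(** For [2 * M <= k ^ (1 - 1 / l)] this gives [(2 * M / k) ^ l <= 1 / k]. *)
Lemma powR_compl_expr (R : realType) (k l : nat) : (0 < l)%N ->
  (k%:R `^ (1 - l%:R^-1)) ^+ l = k%:R ^+ l.-1 :> R.
Proof.
move=> l0; rewrite -powR_mulrn ?powR_ge0 // -powRrM mulrBl mul1r mulVf; last first.
  by rewrite pnatr_eq0 -lt0n.
by rewrite -[in RHS]powR_mulrn // -subn1 natrB.
Qed.

Theorem theoremA1 (R : realType) :
  exists (c p : R), 0 < c /\ 0 < p /\
  forall (k l : nat), (2 <= k)%N -> (1 <= l)%N ->
  exists (d n : nat) (X : 'I_n -> 'rV[R]_d) (r : rule R d l),
    [/\ injective X, is_rule r, 0 < OPT k (Xs X) &
        p <= kmpp_prob X r k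
               (fun C => c * (k%:R `^ (1 - l%:R^-1)) * OPT k (Xs X)
                         <= phi_set (Xs X) C)].
Proof.
exists (1 / 8), (1 / 48); split; first by lra.
split; first by lra.
move=> k l k2 l1; pose j0 := Ordinal l1; set K : R := _ `^ _.
have k2R : 2 <= k%:R :> R by rewrite ler_nat.
have l1R : 1 <= l%:R :> R by rewrite ler1n.
have lV : 0 <= 1 - l%:R^-1 :> R by rewrite subr_ge0 invf_le1 //; lra.
have lV1 : 1 - l%:R^-1 <= 1 :> R by rewrite gerBl invr_ge0.
have K1 : 1 <= K by rewrite -(powRr0 k%:R) /K ler_powR //; lra.
have Kk : K <= k%:R by rewrite -[leRHS]powRr1 ?ler_powR //; lra.
(* The constant 1/8 comes from [K <= 4 * M] and [OPT <= 2 * delta ^ 2]. *)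
have event M (C : seq 'rV[R]_(k + M)) : (0 < M <= k)%N -> K <= 4 * M%:R ->
    M%:R * @delta R k ^+ 2 <= phi_set (Xs (@X R k M)) C ->
    1 / 8 * K * OPT k (Xs (@X R k M)) <= phi_set (Xs (@X R k M)) C.
  move=> /andP[M0 Mk] KM; apply: le_trans.
  have := OPT_X_le (R := R) k2 M0 Mk; have := OPT_X_gt0 (R := R) k2 M0 Mk.
  set O := OPT _ _ => O0 Ole.
  apply: le_trans (_ : 1 / 8 * (4 * M%:R) * (2 * @delta R k ^+ 2) <= _); last by lra.
  by apply: ler_pM => //; lra.
(* For [K < 2], which includes [l = 1], the integer part of [K / 2] is 0; [M = 1] is taken instead
   and every outcome is bad enough. *)
have [K2|K2] := ltP K 2.
  have k1 : (1 <= k)%N by exact: ltnW.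
  pose Y := @X R k 1.
  exists (k + 1)%N, (k + 1)%N, Y, (preference_rule (Y (bad k2 (ltn0Sn 0) k1)) pred0 j0).
  split; [exact: X_inj | exact: preference_ruleP | exact: OPT_X_gt0 |].
  apply: le_trans (_ : 1 <= _); first by lra.
  apply: kmpp_prob_sure => s sk.
  apply: event; [by rewrite k1 | lra |].
  have := phi_set_X_ge_eps (R := R) k2 (ltn0Sn 0) (s := s).
  by rewrite mul1r divr1; apply; rewrite -?size_eq0 sk //; lia.
(* Then [2 * M <= K < 2 * M + 2 <= 4 * M]: the left part bounds the chance of hitting the core, the
   right part the cost. *)
set M := Num.truncn (K / 2).
have K0 : 0 <= K / 2 by lra.
have /andP[MK KM] := truncn_itv K0; rewrite -/M in MK KM.
have M0 : (0 < M)%N by rewrite truncn_gt0; lra.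
have M1 : 1 <= M%:R :> R by rewrite ler1n.
have Mk : (M <= k)%N by rewrite -(ler_nat R); lra.
pose Y := @X R k M.
exists (k + M)%N, (k + M)%N, Y, (preference_rule (Y (bad k2 M0 Mk)) (@core R k M) j0).
split; [exact: X_inj | exact: preference_ruleP | exact: OPT_X_gt0 |].
apply: kmpp_prob_X_ge => // [s sk sfar|].
  apply: event; [by rewrite M0 | move: KM; rewrite -[M.+1%:R]natr1 => KM; lra |].
  by apply: phi_set_X_ge => //; rewrite -size_eq0 sk; lia.
rewrite expr_div_n ler_pdivrMr; last by rewrite exprn_gt0 //; lra.
rewrite -[in leRHS](prednK l1) exprS mulKf; last by lra.
rewrite -powR_compl_expr // -/K.
by apply: lerXn2r; rewrite ?nnegrE; lra.
Qed.
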